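(* Let $\{x_k\}$ be generated by Algorithm TRishBB applied to $f$. Suppose that: (i) $f:\mathbb{R}^n\to\mathbb{R}$ is continuously differentiable, bounded below by $f_*$, and there is $L>0$ with $f(x)\le f(y)+\nabla f(y)^T(x-y)+\frac{L}{2}\|x-y\|^2$ for all $x,y\in\mathbb{R}^n$; (ii) for all $k$, $\mathbb{E}_k[g_k]=\nabla f(x_k)$, and there is a constant $M_g>0$ such that $\mathbb{E}_k[\|\nabla f(x_k)-g_k\|^2]\le M_g$ for all $k$; (iii) $$0<\alpha\le\frac{\gamma_2}{8\gamma_1^2L},\qquad \mu_{min}\ge\frac{4\gamma_1\alpha}{5}.$$ Then the generated sequence satisfies $$\mathbb{E}\left[\frac1K\sum_{k=1}^K\|\nabla f(x_k)\|^2\right]\ \xrightarrow{K\to\infty}\ \left(\frac{16\gamma_1^2}{\gamma_2^2}-1\right)M_g.$$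
   Context: Objective: $f(x)=\frac1N\sum_{i=1}^N f_i(x)$ with each $f_i:\mathbb{R}^n\to\mathbb{R}$ continuously differentiable. $\|\cdot\|$ is the Euclidean norm. Algorithm TRishBB: choose an initial $x_0\in\mathbb{R}^n$, constants $\alpha>0$, $0<\gamma_2\le\gamma_1<\infty$, $\mu_{min}>0$, and $\mu_0>0$. At each iteration $k=0,1,2,\dots$: compute a stochastic gradient $g_k\in\mathbb{R}^n$ (a random vector approximating $\nabla f(x_k)$); set $$\Delta_k=\begin{cases}\alpha\gamma_1\|g_k\| & \text{if }\|g_k\|\in[0,\frac1{\gamma_1}),\\ \alpha & \text{if }\|g_k\|\in[\frac1{\gamma_1},\frac1{\gamma_2}],\\ \alpha\gamma_2\|g_k\| & \text{if }\|g_k\|\in(\frac1{\gamma_2},\infty);\end{cases}$$ let $p_k$ be the solution of $\min_{p\in\mathbb{R}^n} m_k(p)=g_k^Tp+\frac{1}{2\mu_k}\|p\|^2$ subject to $\|p\|\le\Delta_k$ (so $p_k=-\mu_kg_k$ if $\|\mu_kg_k\|<\Delta_k$, and $p_k=-\frac{\Delta_k}{\|g_k\|}g_k$ otherwise, with $p_k=0$ if $g_k=0$); set $x_{k+1}=x_k+p_k$; form a parameter $\mu_{k+1}\ge\mu_{min}$. It is assumed that $\mu_k\ge\mu_{min}$ for all $k\ge0$. $\mathbb{E}_k[\cdot]$ is the conditional expectation given that the algorithm has reached $x_k$ at iteration $k$; $\mathbb{E}[\cdot]$ is the expected value taken with the joint distribution of all random variables.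
   Formalization: Convergence of the averaged expectation to the stated constant is false (f = 0, g_k = 0 gives 0 for every K, while the constant is positive); the formal theorem proves that the limit superior of the averages is at most that same constant. *)

(* Defs.v *)
From HB Require Import structures.
From mathcomp Require Import all_boot all_order all_algebra.
From mathcomp Require Import all_classical all_reals all_analysis.

Set Implicit Arguments.
Unset Strict Implicit.
Unset Printing Implicit Defensive.

Import Order.TTheory GRing.Theory Num.Theory.
Import numFieldNormedType.Exports.

Local Open Scope classical_set_scope.
Local Open Scope ring_scope.

Section Euclidean.
Context {R : realType} {n : nat}.
Implicit Types (u v x : 'rV[R]_n) (f : 'rV[R]_n -> R).

Definition dot u v : R := \sum_(i < n) u ord0 i * v ord0 i.

(* The library norm `|u| on 'rV[R]_n is the sup norm, hence this definition;
   the two induce the same topology, so the library's [differentiable] and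
   [continuous] are the usual notions. *)
Definition enorm u : R := Num.sqrt (dot u u).

Definition grad f x : 'rV[R]_n := \row_(i < n) 'D_(delta_mx ord0 i) f x.

Definition cont_diff f : Prop :=
  (forall x, differentiable f x) /\ continuous (grad f).

End Euclidean.

Section ConditionalExpectation.
Context {R : realType} {d : measure_display} {T : measurableType d}.
Implicit Types (P : probability T R) (G : set (set T)) (X Y : T -> R).

Definition is_sub_sigma G : Prop :=
  sigma_algebra setT G /\ G `<=` measurable.

Definition measurable_wrt G Y : Prop :=
  forall B : set R, measurable B -> G (Y @^-1` B).

(* Y is a version of E[X | G]. *)
Definition is_cond_exp P G X Y : Prop :=
  [/\ P.-integrable setT (EFin \o X),
      P.-integrable setT (EFin \o Y),
      measurable_wrt G Y &
      forall A, G A ->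
        (\int[P]_(w in A) (X w)%:E = \int[P]_(w in A) (Y w)%:E)%E].

Definition is_cond_exp_vec n P G (X Y : T -> 'rV[R]_n) : Prop :=
  forall i, is_cond_exp P G (fun w => X w ord0 i) (fun w => Y w ord0 i).

(* E[X | G] exists and is at most M almost surely. *)
Definition cond_exp_le P G X (M : R) : Prop :=
  exists2 Y, is_cond_exp P G X Y & {ae P, forall w, Y w <= M}.

Definition random_vector n (X : T -> 'rV[R]_n) : Prop :=
  forall i, measurable_fun setT (fun w => X w ord0 i).

End ConditionalExpectation.

Section TRishBB.
Context {R : realType} {n : nat}.

(* t stands for the norm of g_k. *)
Definition tr_radius (alpha gamma1 gamma2 t : R) : R :=
  if t < gamma1^-1 then alpha * gamma1 * t
  else if t <= gamma2^-1 then alpha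
  else alpha * gamma2 * t.

Definition tr_model (g : 'rV[R]_n) (mu : R) (p : 'rV[R]_n) : R :=
  dot g p + (2 * mu)^-1 * enorm p ^+ 2.

Definition tr_solution (g : 'rV[R]_n) (mu Delta : R) (p : 'rV[R]_n) : Prop :=
  enorm p <= Delta /\
  forall q, enorm q <= Delta -> tr_model g mu p <= tr_model g mu q.

(* A run of the algorithm on the probability space T. No rule for choosing mu
   is imposed beyond measurability and the lower bound mumin: the mu k may
   depend on anything, in particular on all past iterates and gradients. *)
Record TRishBB_run {d : measure_display} {T : measurableType d}
    (alpha gamma1 gamma2 mumin mu0 : R) (x0 : 'rV[R]_n)
    (x g p : nat -> T -> 'rV[R]_n) (mu : nat -> T -> R) : Prop := {
  run_x0 : forall w, x 0%N w = x0;
  run_mu0 : forall w, mu 0%N w = mu0;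
  run_g_random : forall k, random_vector (g k);
  run_mu_random : forall k, measurable_fun setT (mu k);
  run_mu_ge : forall k w, mumin <= mu k w;
  run_step : forall k w,
    tr_solution (g k w) (mu k w)
      (tr_radius alpha gamma1 gamma2 (enorm (g k w))) (p k w);
  run_next : forall k w, x k.+1 w = x k w + p k w
}.

End TRishBB.

(* Main.v *)
(* Solving the trust-region subproblem gives p_k = - theta_k g_k with
   a <= theta_k <= b, where a = 4 alpha gamma2 / 5 and b = alpha gamma1.  Since
   - 2 G.g = |G - g|^2 - |G|^2 - |g|^2 and L b <= 1, the descent inequality
   yields pointwise, whatever theta_k depends on,
     a/2 |grad f(x_k)|^2 <= f(x_k) - f(x_{k+1}) + b/2 |grad f(x_k) - g_k|^2.
   Summing from k = 0, where f(x_0) is deterministic, and taking expectations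
   bounds the averages by (b/a) Mg + O(1/K), which is eventually below the
   claimed limit. *)

Require Import Defs.
From HB Require Import structures.
From mathcomp Require Import all_boot all_order all_algebra.
From mathcomp Require Import all_classical all_reals all_analysis.
From mathcomp Require Import measurable_realfun ring lra.
Set Implicit Arguments.
Unset Strict Implicit.
Unset Printing Implicit Defensive.

Import Order.TTheory GRing.Theory Num.Theory.
Import numFieldNormedType.Exports.
Local Open Scope classical_set_scope.
Local Open Scope ring_scope.

(** * Algebra of the Euclidean inner product *)

Section EuclideanTheory.
Context {R : realType} {n : nat}.
Implicit Types u v w : 'rV[R]_n.

Lemma dotC u v : dot u v = dot v u.
Proof. by apply: eq_bigr => i _; rewrite mulrC. Qed.

Lemma dotDl u v w : dot (u + v) w = dot u w + dot v w.
Proof. by rewrite -big_split; apply: eq_bigr => i _; rewrite mxE mulrDl. Qed.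

Lemma dotZl a u v : dot (a *: u) v = a * dot u v.
Proof. by rewrite /dot mulr_sumr; apply: eq_bigr => i _; rewrite mxE mulrA. Qed.

Lemma dotNl u v : dot (- u) v = - dot u v.
Proof. by rewrite -scaleN1r dotZl mulN1r. Qed.

Lemma dotDr u v w : dot w (u + v) = dot w u + dot w v.
Proof. by rewrite !(dotC w) dotDl. Qed.

Lemma dotZr a u v : dot u (a *: v) = a * dot u v.
Proof. by rewrite !(dotC u) dotZl. Qed.

Lemma dotNr u v : dot u (- v) = - dot u v.
Proof. by rewrite !(dotC u) dotNl. Qed.

Definition dotE := (dotDl, dotDr, dotNl, dotNr, dotZl, dotZr).

Lemma dot_ge0 u : 0 <= dot u u.
Proof. by apply: sumr_ge0 => i _; rewrite -expr2 sqr_ge0. Qed.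

Lemma dot_eq0 u : dot u u = 0 -> u = 0.
Proof.
move=> uu0; apply/rowP => i; rewrite mxE; apply/eqP; rewrite -sqrf_eq0 expr2.
move/eqP: uu0; rewrite psumr_eq0 => [/allP/(_ i (mem_index_enum i))//|j _].
by rewrite -expr2 sqr_ge0.
Qed.

Lemma enorm_ge0 u : 0 <= enorm u.
Proof. exact: sqrtr_ge0. Qed.

Lemma sqr_enorm u : enorm u ^+ 2 = dot u u.
Proof. by rewrite sqr_sqrtr ?dot_ge0. Qed.

End EuclideanTheory.

(** * Closed form of the trust-region step *)

Section TrustRegionStep.
Context {R : realType} {n : nat}.
Implicit Types g p : 'rV[R]_n.

(** This removes the case split on the radius: the ratio is [alpha * gamma1], [alpha / t] or
    [alpha * gamma2]. *)
Lemma tr_radius_ratio (alpha gamma1 gamma2 t : R) :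
    0 < alpha -> 0 < gamma2 -> gamma2 <= gamma1 ->
  exists2 rho, alpha * gamma2 <= rho <= alpha * gamma1 &
    tr_radius alpha gamma1 gamma2 t = rho * t.
Proof.
move=> a0 g0 g12; have g10 : 0 < gamma1 by exact: lt_le_trans g12.
have le12 : alpha * gamma2 <= alpha * gamma1 by rewrite ler_pM2l.
rewrite /tr_radius; case: ltP => [_|t1].
  by exists (alpha * gamma1); rewrite ?le12 ?lexx.
have t0 : 0 < t by apply: lt_le_trans t1; rewrite invr_gt0.
case: leP => [t2|_]; last by exists (alpha * gamma2); rewrite ?le12 ?lexx.
exists (alpha / t); last by rewrite divfK// gt_eqF.
rewrite !ler_pM2l//; apply/andP; split.
- by rewrite -[leLHS]invrK lef_pV2 ?posrE ?invr_gt0.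
- by rewrite -[leRHS]invrK lef_pV2 ?posrE ?invr_gt0.
Qed.

(** Strong convexity: the candidate [q] is feasible and satisfies the variational inequality
    [first_order], so any minimizer coincides with it. *)
Lemma tr_solutionE g (mu rho : R) p : 0 < mu -> 0 < rho ->
    tr_solution g mu (rho * enorm g) p ->
  p = - (Num.min mu rho *: g).
Proof.
move=> mu0 rho0 [ple pmin]; set th := Num.min mu rho.
have th0 : 0 < th by rewrite lt_min mu0.
have thmu : th <= mu by rewrite ge_min lexx.
have thrho : th <= rho by rewrite ge_min lexx orbT.
pose q := - (th *: g).
have qq : dot q q = th ^+ 2 * dot g g by rewrite /q !dotE; ring.
have qle : enorm q <= rho * enorm g.
  rewrite -(@ler_pXn2r _ 2) ?nnegrE ?mulr_ge0 ?enorm_ge0 ?(ltW rho0)//.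
  rewrite exprMn !sqr_enorm qq ler_wpM2r ?dot_ge0//.
  by rewrite ler_pXn2r ?nnegrE// ltW.
have pp : dot p p <= rho ^+ 2 * dot g g.
  rewrite -!sqr_enorm -exprMn ler_pXn2r ?nnegrE ?enorm_ge0//.
  by rewrite mulr_ge0 ?enorm_ge0// ltW.
have := pmin q qle; rewrite /tr_model !sqr_enorm => mpq.
(* Either [th = mu], or [th = rho] and Cauchy-Schwarz gives the bound. *)
have first_order : 0 <= (mu - th) * (dot g p + th * dot g g).
  have [thE|] : th = mu \/ th = rho.
  - by rewrite /th; case: leP; [left|right].
  - by rewrite thE subrr mul0r.
  move=> thE; rewrite mulr_ge0 ?subr_ge0// thE -(@pmulr_rge0 _ rho)//.
  have := dot_ge0 (rho *: g + p); rewrite !dotE (dotC p g) => h.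
  nra.
(* [2 * mu] times the model gap between [p] and [q] is [|p - q|^2] plus twice the quantity in
   [first_order]. *)
have pq0 : dot (p - q) (p - q) <= 0.
  have mpq' : 2 * mu * dot g p + dot p p <= 2 * mu * dot g q + dot q q.
    have mu20 : 0 < 2 * mu by rewrite mulr_gt0.
    rewrite -(ler_pM2l mu20) !mulrDr !mulrA divff ?gt_eqF// !mul1r in mpq.
    exact: mpq.
  by move: mpq'; rewrite qq /q !dotE (dotC p g); nra.
apply/subr0_eq/dot_eq0/eqP; rewrite eq_le pq0/=; exact: dot_ge0.
Qed.

End TrustRegionStep.

Lemma descent_step (R : realType) (n : nat) (f : 'rV[R]_n -> R) (L a b th : R)
    (x g : 'rV[R]_n) :
    0 < L -> 0 <= a -> a <= th -> th <= b -> L * b <= 1 ->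
    (forall y z,
      f y <= f z + dot (grad f z) (y - z) + L / 2 * enorm (y - z) ^+ 2) ->
  a / 2 * enorm (grad f x) ^+ 2 <=
  f x - f (x - th *: g) + b / 2 * enorm (grad f x - g) ^+ 2.
Proof.
move=> L0 a0 ath thb Lb /(_ (x - th *: g) x).
have -> : x - th *: g - x = - (th *: g) by rewrite addrAC subrr add0r.
rewrite !sqr_enorm !dotE (dotC g (grad f x)).
move: (dot_ge0 (grad f x - g)); rewrite !dotE (dotC g (grad f x)).
move: (dot_ge0 g) (dot_ge0 (grad f x)).
move: (dot g g) (dot (grad f x) g) (dot (grad f x) (grad f x)) => gg Gg GG gg0 GG0 V0 le_f.
(* After polarization, the right side minus the left is at least half the sum of the terms in [h1],
   [h2] and [h3]. *)
have h1 : (th - a) * GG >= 0 by rewrite mulr_ge0 ?subr_ge0.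
have b_th : 0 <= b - th by rewrite subr_ge0.
have h2 := mulr_ge0 b_th V0.
have h3 : th * (1 - L * th) * gg >= 0.
  apply: mulr_ge0 => //; apply: mulr_ge0; first exact: le_trans ath.
  by rewrite subr_ge0; apply: le_trans Lb; rewrite ler_pM2l.
nra.
Qed.

(** * Expectation bounds *)

Section Probability.
Context {d : measure_display} {T : measurableType d} {R : realType}.
Variable P : probability T R.

(** Tower property: take the whole space as test event. *)
Lemma cond_exp_le_integral (G : set (set T)) (X : T -> R) (M : R) :
  0 <= M -> is_sub_sigma G -> cond_exp_le P G X M ->
  (\int[P]_w (X w)%:E <= M%:E)%E.
Proof.
move=> M0 [[G0 GC _] _] [Y [iX iY _ XY] YM].
have GT : G setT by rewrite -(setD0 setT); exact: GC.
rewrite (XY _ GT).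
have -> : M%:E = (\int[P]_w (cst M%:E w))%E.
  by rewrite -[LHS](expectation_cst P) unlock.
have iYp := integrable_funepos measurableT iY.
(* The almost sure comparison is made between nonnegative functions; [0 <= M] keeps the positive
   part of [Y] below [M]. *)
apply: (@le_trans _ _ (\int[P]_w (EFin \o Y)^\+ w)%E).
  by apply: le_integral => // w _; rewrite funeposE le_max lexx.
apply: ae_ge0_le_integral => //.
- exact: measurable_int iYp.
- case: YM => A [mA PA0 YA]; exists A; split=> //.
  apply: subset_trans YA; apply: subsetC => w /= Yw _.
  by rewrite funeposE/= ge_max !lee_fin Yw.
Qed.

(** Nonnegativity allows termwise integration in the extended reals. *)
Lemma ge0_expectation_affine_le (V : nat -> T -> R) (c0 c1 M : R) (m : nat) :
    0 <= c0 -> 0 <= c1 -> (forall k w, 0 <= V k w) ->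
    (forall k, measurable_fun setT (V k)) ->
    (forall k, (\int[P]_w (V k w)%:E <= M%:E)%E) ->
  ('E_P[fun w => (c0 + c1 * \sum_(k < m) V k w)%R] <= (c0 + c1 * (m%:R * M))%:E)%E.
Proof.
move=> c00 c10 V0 mV VM; rewrite unlock.
under eq_integral => w _ do rewrite EFinD EFinM -sumEFin.
pose S w : \bar R := (\sum_(k < m) (V k w)%:E)%E.
have mS : measurable_fun setT S.
  by apply: emeasurable_sum => k; exact/measurable_EFinP.
have S0 w : setT w -> (0 <= S w)%E.
  by move=> _; apply: sume_ge0 => k _; rewrite lee_fin.
rewrite ge0_integralD//; last 2 first.
- by move=> w Tw; rewrite mule_ge0 ?S0.
- exact: measurable_funeM.
rewrite ge0_integralZl_EFin// ge0_integral_sum//; last 2 first.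
- by move=> k; exact/measurable_EFinP.
- by move=> k w _; rewrite lee_fin.
have -> : (\int[P]_w c0%:E = c0%:E)%E by rewrite -[RHS](expectation_cst P) unlock.
rewrite EFinD EFinM.
rewrite leeD2l// lee_wpmul2l ?lee_fin//.
apply: (@le_trans _ _ (\sum_(k < m) M%:E)%E); first exact: lee_sum.
by rewrite sumEFin sumr_const card_ord mulr_natl.
Qed.

End Probability.

(** The limit superior is an infimum of suprema over neighbourhoods of infinity, and the set where
    [u k <= l] is one of them. *)
Lemma limn_esup_le_near (R : realType) (u : (\bar R)^nat) (l : \bar R) :
  (\forall k \near \oo, (u k <= l)%E) -> (limn_esup u <= l)%E.
Proof.
move=> ul; apply: (@le_trans _ _ (ereal_sup (u @` [set k | (u k <= l)%E]))).
  by apply: ereal_inf_lbound; exists [set k | (u k <= l)%E].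
by apply: ge_ereal_sup => _ [k ukl <-].
Qed.

Lemma measurable_sqr_enorm (d : measure_display) (T : measurableType d)
    (R : realType) (n : nat) (X : T -> 'rV[R]_n) :
  random_vector X -> measurable_fun setT (fun w => enorm (X w) ^+ 2).
Proof.
move=> mX; under eq_fun do rewrite sqr_enorm /dot.
by apply: measurable_sum => i; exact: measurable_funM.
Qed.

Unset Implicit Arguments.

(** The arrow is read as an upper bound on the limit superior: for constant [f] and zero [g] the
    averages vanish while the right side is positive. *)
Theorem theorem3p4 (R : realType) (d : measure_display) (T : measurableType d)
  (P : probability T R)
  (n N : nat) (fi : 'I_N -> 'rV[R]_n -> R) (f : 'rV[R]_n -> R)
  (alpha gamma1 gamma2 mumin mu0 fstar L Mg : R) (x0 : 'rV[R]_n)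
  (x g p : nat -> T -> 'rV[R]_n) (mu : nat -> T -> R)
  (F : nat -> set (set T))
  (* the objective *)
  (hN : (0 < N)%N)
  (hfi : forall i, cont_diff (fi i))
  (hf : forall y, f y = N%:R^-1 * \sum_(i < N) fi i y)
  (* the algorithm *)
  (halpha : 0 < alpha)
  (hgamma2 : 0 < gamma2) (hgamma : gamma2 <= gamma1)
  (hmumin : 0 < mumin) (hmu0 : 0 < mu0)
  (hrun : TRishBB_run alpha gamma1 gamma2 mumin mu0 x0 x g p mu)
  (* F k is the information on which E_k conditions; it includes x_k *)
  (hF : forall k, is_sub_sigma (F k))
  (hFx : forall k (i : 'I_n), measurable_wrt (F k) (fun w => x k w ord0 i))
  (* (i) *)
  (hC1 : cont_diff f)
  (hbelow : forall y, fstar <= f y)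
  (hL : 0 < L)
  (hsmooth : forall y z,
    f y <= f z + dot (grad f z) (y - z) + L / 2 * enorm (y - z) ^+ 2)
  (* (ii) *)
  (hunbiased : forall k,
    is_cond_exp_vec P (F k) (g k) (fun w => grad f (x k w)))
  (hMg : 0 < Mg)
  (hvar : forall k,
    cond_exp_le P (F k) (fun w => enorm (grad f (x k w) - g k w) ^+ 2) Mg)
  (* (iii) *)
  (halpha_le : alpha <= gamma2 / (8 * gamma1 ^+ 2 * L))
  (hmumin_ge : 4 * gamma1 * alpha / 5 <= mumin) :
  (limn_esup (fun K : nat =>
     'E_P[fun w => (K%:R^-1 *
            \sum_(1 <= k < K.+1) enorm (grad f (x k w)) ^+ 2)%R])
   <= ((16 * gamma1 ^+ 2 / gamma2 ^+ 2 - 1) * Mg)%:E)%E.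
Proof.
have hgamma1 : 0 < gamma1 by exact: lt_le_trans hgamma.
(* The factor 4/5 matches [hmumin_ge]: [a] must lie below both [mumin] and [alpha * gamma2]. *)
pose a := 4 * alpha * gamma2 / 5.
pose b := alpha * gamma1.
have a0 : 0 < a by rewrite /a divr_gt0// !mulr_gt0.
have b0 : 0 < b by rewrite mulr_gt0.
have a20 : 0 < a / 2 by exact: divr_gt0.
have le12 : alpha * gamma2 <= alpha * gamma1 by rewrite ler_pM2l.
have a_mumin : a <= mumin by apply: le_trans hmumin_ge; rewrite /a; lra.
have a_le : a <= alpha * gamma2.
  have : 0 < alpha * gamma2 by rewrite mulr_gt0.
  by rewrite /a; lra.
(* [halpha_le] and [gamma2 <= gamma1] even give [L * b <= 1/8]. *)
have Lb1 : L * b <= 1.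
  have den0 : 0 < 8 * gamma1 ^+ 2 * L by rewrite !mulr_gt0// exprn_gt0.
  rewrite ler_pdivlMr// in halpha_le.
  rewrite -(ler_pM2r hgamma1) /b; nra.
pose V k w := enorm (grad f (x k w) - g k w) ^+ 2.
pose G2 k w := enorm (grad f (x k w)) ^+ 2.
have step k w : a / 2 * G2 k w <= f (x k w) - f (x k.+1 w) + b / 2 * V k w.
  have [rho /andP[rho1 rho2] radE] :=
    tr_radius_ratio (enorm (g k w)) halpha hgamma2 hgamma.
  have mu_ge := run_mu_ge hrun k w.
  have mu_gt0 := lt_le_trans hmumin mu_ge.
  have rho0 : 0 < rho by apply: lt_le_trans rho1; rewrite mulr_gt0.
  have := run_step hrun k w; rewrite radE => /(tr_solutionE mu_gt0 rho0) pE.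
  rewrite (run_next hrun) pE.
  apply: (descent_step (L := L)) => //; first exact: ltW.
  - by rewrite le_min (le_trans a_mumin)// (le_trans a_le).
  - by rewrite ge_min rho2 orbT.
have telescoped m w : a / 2 * \sum_(k < m) G2 k w <=
    f x0 - f (x m w) + b / 2 * \sum_(k < m) V k w.
  elim: m => [|m IH]; first by rewrite !big_ord0 !mulr0 (run_x0 hrun); lra.
  by rewrite !big_ord_recr /=; have := step m w; lra.
(* Measurability comes with the integrability contained in [hunbiased]. *)
have mgrad k : random_vector (fun w => grad f (x k w)).
  by move=> i; case: (hunbiased k i) => _ /measurable_int/measurable_EFinP.
have mG2 k : measurable_fun setT (G2 k) by exact: measurable_sqr_enorm.
have mV k : measurable_fun setT (V k).
  apply: measurable_sqr_enorm => i.
  rewrite (_ : (fun w => _) = (fun w => grad f (x k w) ord0 i - g k w ord0 i)).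
    apply: measurable_funB; [exact: mgrad|exact: (run_g_random hrun)].
  by apply/funext => w; rewrite !mxE.
have G20 k w : 0 <= G2 k w by exact: sqr_ge0.
have V0 k w : 0 <= V k w by exact: sqr_ge0.
have VMg k : (\int[P]_w (V k w)%:E <= Mg%:E)%E.
  by apply: cond_exp_le_integral (hF k) (hvar k); exact: ltW.
have D0 : 0 <= f x0 - fstar by rewrite subr_ge0.
have bound (K : nat) : (0 < K)%N ->
    ('E_P[fun w => (K%:R^-1 * \sum_(1 <= k < K.+1) G2 k w)%R] <=
     (K%:R^-1 * (2 / a * (f x0 - fstar)) +
      K%:R^-1 * (b / a) * (K.+1%:R * Mg))%:E)%E.
  move=> K0; have Ki0 : 0 <= K%:R^-1 :> R by rewrite invr_ge0.
  have c00 : 0 <= K%:R^-1 * (2 / a * (f x0 - fstar)).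
    by rewrite mulr_ge0// mulr_ge0// divr_ge0// ltW.
  have c10 : 0 <= K%:R^-1 * (b / a).
    by rewrite mulr_ge0// divr_ge0// ltW.
  apply: le_trans (ge0_expectation_affine_le K.+1 c00 c10 V0 mV VMg).
  apply: expectation_le.
  - by apply: measurable_funM => //; exact: measurable_sum.
  - apply: measurable_funD => //; apply: measurable_funM => //.
    exact: measurable_sum.
  - by move=> w; rewrite mulr_ge0// sumr_ge0.
  - by move=> w; rewrite addr_ge0// mulr_ge0// sumr_ge0.
  apply: aeW => w; rewrite -[X in _ + X]mulrA -mulrDr ler_wpM2l//.
  have -> : 2 / a * (f x0 - fstar) + b / a * \sum_(k < K.+1) V k w =
      (f x0 - fstar + b / 2 * \sum_(k < K.+1) V k w) / (a / 2).
    by field; rewrite gt_eqF.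
  rewrite ler_pdivlMr// mulrC.
  (* Adding the nonnegative term [k = 0] aligns the average with the telescoped sum, at the price of
     [K.+1] noise terms. *)
  have le_sum : \sum_(1 <= k < K.+1) G2 k w <= \sum_(k < K.+1) G2 k w.
    rewrite -[leRHS](big_mkord xpredT (fun k => G2 k w)).
    by rewrite [leRHS]big_ltn// ler_wpDl.
  apply: le_trans (_ : a / 2 * \sum_(k < K.+1) G2 k w <= _).
    by rewrite ler_pM2l.
  (* The last value of [f] is bounded by [fstar] pointwise, before integration. *)
  by have := telescoped K.+1 w; have := hbelow (x K.+1 w); lra.
pose C := (16 * gamma1 ^+ 2 / gamma2 ^+ 2 - 1) * Mg.
(* With r = gamma1 / gamma2 >= 1, b / a = 5 r / 4 lies strictly below
   16 r^2 - 1, and the gap absorbs the O(1/K) terms. *)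
have gap : 0 < C - b / a * Mg.
  pose r := gamma1 / gamma2.
  have r1 : 1 <= r by rewrite ler_pdivlMr// mul1r.
  have -> : C - b / a * Mg = (16 * r ^+ 2 - 1 - 5 / 4 * r) * Mg.
    by rewrite /C /r /a /b; field; rewrite !gt_eqF.
  by rewrite mulr_gt0//; nra.
(* The estimate in [bound] equals [b / a * Mg + E / K]; the second summand of [E] comes from the
   extra noise term. *)
pose E := 2 / a * (f x0 - fstar) + b / a * Mg.
apply: limn_esup_le_near.
near=> K.
have K0 : (0 < K)%N by near: K; exact: nbhs_infty_gt.
apply: le_trans (bound K K0) _; rewrite lee_fin -/C.
have KR0 : 0 < K%:R :> R by rewrite ltr0n.
have EK : E / (C - b / a * Mg) <= K%:R by near: K; exact: nbhs_infty_ger.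
rewrite ler_pdivrMr// in EK.
rewrite -[X in _ + X]mulrA -mulrDr mulrC ler_pdivrMr// -natr1 mulrDl mul1r.
by rewrite /E in EK; lra.
Unshelve. all: by end_near. Qed.
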